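(* Suppose $S=S(\lambda_1, \dots, \lambda_d)$ is an $n$-vertex spider with $(\lambda_1, \dots, \lambda_d)$ a partition. Pick some $\lambda_i$ with $2\leq i<d$, let $n = q (\lambda_i + 1) + r$ where $0\leq r <\lambda _i +1$, $r = qd' + r'$ where $0\leq r' <q$ (with $q,r,d',r'$ nonnegative integers), and let $t = \lambda_{i+1} + \dots + \lambda_d$, where $t>1$. If $q \geq \frac{\lambda_i + 1}{t - 1}$, then $S$ is missing a connected partition of type $$(\lambda_i + d' + 2)^{r'} (\lambda_i + d' + 1)^{q-r'}.$$
   Context: Given a partition $\lambda=(\lambda_1\ge\cdots\ge\lambda_d>0)$ of $n-1$ with $d\ge 3$ parts, the spider $S(\lambda_1,\ldots,\lambda_d)$ is the $n$-vertex tree consisting of $d$ disjoint paths $P_{\lambda_1},\ldots,P_{\lambda_d}$ (the legs), where $P_k$ denotes the path with $k$ vertices, together with one further vertex (the centre) joined to one end vertex of each path. A connected partition of an $n$-vertex graph $G$ is a partitioning of its vertex set into $\{V_1,\ldots,V_k\}$ such that the subgraph induced by each $V_j$ is connected; its type is the partition of $n$ obtained by sorting the sizes $|V_j|$ in decreasing order. $G$ is missing a connected partition of type $\mu$ if no connected partition of $G$ has type $\mu$. The notation $a^{r'}b^{q-r'}$ denotes the partition with $r'$ parts equal to $a$ and $q-r'$ parts equal to $b$. *)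

(* Defs.v *)
From mathcomp Require Import all_boot.

Set Implicit Arguments.
Unset Strict Implicit.
Unset Printing Implicit Defensive.

Definition intpart (s : seq nat) : bool := sorted geq s && all (leq 1) s.

(* Parts are numbered from 1: [part s k] is the k-th largest part, for
   1 <= k <= size s. *)
Definition part (s : seq nat) (k : nat) : nat := nth 0 s k.-1.

Section ConnectedPartition.

(* A graph on T is given by its adjacency relation e. *)
Variables (T : finType) (e : rel T).

Definition induced (B : {set T}) : rel T :=
  [rel x y | [&& x \in B, y \in B & e x y]].

Definition induces_connected (B : {set T}) : Prop :=
  B != set0 /\ {in B &, forall x y, connect (induced B) x y}.

Definition connected_partition (P : {set {set T}}) : Prop :=
  partition P [set: T] /\ {in P, forall B, induces_connected B}.

Definition partition_type (P : {set {set T}}) : seq nat :=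
  sort geq [seq #|pred_of_set B| | B <- enum P].

Definition missing (mu : seq nat) : Prop :=
  ~ exists P, connected_partition P /\ partition_type P = mu.

End ConnectedPartition.

(* [None] is the centre; [Some (Tagged _ k)] with tag j is the vertex at
   distance k + 1 from the centre on the leg with [part lam j.+1] vertices. *)
Definition spider_vertex (lam : seq nat) : finType :=
  option {j : 'I_(size lam) & 'I_(part lam j.+1)}.

Definition spider (lam : seq nat) : rel (spider_vertex lam) :=
  fun x y =>
    match x, y with
    | None, None => false
    | None, Some v => tagged v == 0 :> nat
    | Some u, None => tagged u == 0 :> nat
    | Some u, Some v =>
        (tag u == tag v) && (((tagged u).+1 == tagged v :> nat)
                             || ((tagged v).+1 == tagged u :> nat))
    end.

Lemma card_spider (lam : seq nat) : #|spider_vertex lam| = (sumn lam).+1.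
Proof.
rewrite card_option card_tagged !sumnE big_map big_enum /= (big_nth 0) big_mkord.
by congr _.+1; apply: eq_bigr => j _; rewrite card_ord.
Qed.

(* Main.v *)
Require Import Defs.
From mathcomp Require Import all_boot all_order all_algebra.
From mathcomp Require Import zify.

Import Order.TTheory GRing.Theory Num.Theory.

(** Write [a] for the i-th largest part.  The type in question only has parts of
    size at least [a + 1], whereas each of the legs i, ..., d has at most [a]
    vertices.  A block of a connected partition that avoids the centre lies
    within one leg ([avoids_centre_sub_leg]), so no vertex of the legs
    i, ..., d can be in such a block: the block of the centre swallows all of
    these legs and has at least [1 + a + t] vertices ([centre_block_large]).
    As no part exceeds [a + d' + 2], this forces [t - 1 <= d'].  But
    [q * d' <= r < a + 1 <= q * (t - 1)], so [d' < t - 1]. *)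

Definition legs (lam : seq nat) (A : pred 'I_(size lam)) :
    {set spider_vertex lam} :=
  [set Some u | u in [pred u | A (tag u)]].

Lemma mem_legs (lam : seq nat) (A : pred 'I_(size lam)) v :
  (Some v \in legs lam A) = A (tag v).
Proof. by rewrite mem_imset //; exact: Some_inj. Qed.

Lemma centre_notin_legs (lam : seq nat) (A : pred 'I_(size lam)) :
  None \notin legs lam A.
Proof. by apply/imsetP => -[]. Qed.

Lemma card_legs (lam : seq nat) (A : pred 'I_(size lam)) :
  #|legs lam A| = \sum_(j | A j) part lam j.+1.
Proof.
rewrite card_imset; last exact: Some_inj.
rewrite -sum1_card.
transitivity (\sum_(j | A j) \sum_(k : 'I_(part lam j.+1)) 1); last first.
  by apply: eq_bigr => j _; rewrite sum1_card card_ord.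
by rewrite sig_big_dep /=; apply: eq_bigl => u; rewrite inE andbT.
Qed.

(** Distinct legs are only joined through the centre, so that inside a set
    avoiding the centre the leg of a vertex is constant along edges. *)
Lemma avoids_centre_sub_leg (lam : seq nat) (B : {set spider_vertex lam}) v :
  induces_connected (@spider lam) B -> None \notin B -> Some v \in B ->
  B \subset legs lam (pred1 (tag v)).
Proof.
move=> [_ connB] NB vB; apply/subsetP => w wB.
have clos : closed (induced (@spider lam) B) (legs lam (pred1 (tag v))).
  move=> [x|] [y|] /and3P[xB yB] //=; rewrite ?(negPf NB) // in xB yB *.
  by case/andP=> /eqP exy _; rewrite !mem_legs /= exy.
by rewrite -(closed_connect clos (connB _ _ vB wB)) mem_legs /=.
Qed.

Lemma part_anti (lam : seq nat) (i j : nat) :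
  intpart lam -> 0 < i <= j -> j <= size lam -> part lam j <= part lam i.
Proof.
move=> /andP[slam _] /andP[i0 ij] jd.
apply: (sorted_leq_nth (leT := geq)) => //; rewrite ?inE; try lia.
- by move=> x y z /= xy yz; exact: leq_trans yz xy.
- by move=> x /=.
Qed.

(** When every block is larger than leg i, the legs from i on are too short to
    hold a block of their own and are absorbed by the block of the centre. *)
Lemma centre_block_large (lam : seq nat) (i : nat)
    (P : {set {set spider_vertex lam}}) :
  intpart lam -> 0 < i -> connected_partition (@spider lam) P ->
  {in P, forall B : {set spider_vertex lam}, part lam i < #|B|} ->
  exists2 B, B \in P &
    1 + \sum_(i <= k < (size lam).+1) part lam k <= #|B|.
Proof.
move=> plam i0 [partP connP] bigP; have [/eqP covP trivP _] := and3P partP.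
have inP x : x \in cover P by rewrite covP inE.
pose C := pblock P None; exists C; first by rewrite pblock_mem.
pose A := [pred j : 'I_(size lam) | i <= j.+1].
have -> : 1 + \sum_(i <= k < (size lam).+1) part lam k = #|None |: legs lam A|.
  rewrite cardsU1 centre_notin_legs card_legs; congr (_ + _).
  rewrite (big_nat_widenl _ 1) // big_add1 /= big_mkord.
  by apply: eq_bigl => j /=; lia.
apply: subset_leq_card; apply/subsetP => x; rewrite in_setU1.
case/orP=> [/eqP-> | /imsetP[u uA ->]]; first by rewrite mem_pblock.
have [NB|NB] := boolP (None \in pblock P (Some u)).
  by rewrite /C (same_pblock trivP NB) mem_pblock.
have BP : pblock P (Some u) \in P by rewrite pblock_mem.
have uB : Some u \in pblock P (Some u) by rewrite mem_pblock.
have := subset_leq_card (avoids_centre_sub_leg lam _ u (connP _ BP) NB uB).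
rewrite card_legs big_pred1_eq leqNgt (leq_ltn_trans _ (bigP _ BP)) //.
by apply: part_anti => //; rewrite i0.
Qed.

Theorem lemma31 (d n : nat) (lam : seq nat) (i q r d' r' t : nat)
  (hd : size lam = d) (hd3 : 3 <= d)
  (hlam : intpart lam)
  (hn : #|spider_vertex lam| = n)
  (hi : 2 <= i < d)
  (hq : n = q * (part lam i + 1) + r) (hr : 0 <= r < part lam i + 1)
  (hr_eq : r = q * d' + r') (hr' : 0 <= r' < q)
  (ht : t = \sum_(i + 1 <= k < d + 1) part lam k) (ht1 : 1 < t)
  (hbound : (((part lam i)%:R + 1) / (t%:R - 1) <= q%:R :> rat)%R) :
  missing (@spider lam)
    (nseq r' (part lam i + d' + 2) ++ nseq (q - r') (part lam i + d' + 1)).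
Proof.
case=> P [connP typeP].
have sizeP B : B \in P ->
    #|B| = part lam i + d' + 2 \/ #|B| = part lam i + d' + 1.
  move=> BP; have : #|B| \in partition_type P.
    by rewrite mem_sort; apply/mapP; exists B; rewrite ?mem_enum.
  by rewrite typeP mem_cat !mem_nseq => /orP[] /andP[_ /eqP]; [left|right].
have i0 : 0 < i by lia.
have bigP : {in P, forall B : {set spider_vertex lam}, part lam i < #|B|}.
  by move=> B /sizeP; lia.
have [B /sizeP cardB] := centre_block_large lam i P hlam i0 connP bigP.
rewrite hd big_ltn; last by lia.
rewrite -[i.+1]addn1 -[d.+1]addn1 -ht => leB.
have {}hbound : part lam i + 1 <= q * (t - 1).
  move: hbound; rewrite -(natrB _ (ltnW ht1)) ler_pdivrMr ?ltr0n ?subn_gt0 //.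
  by rewrite -(natrD _ _ 1) -natrM ler_nat.
have : q * d' < q * (t - 1) by lia.
by rewrite ltn_mul2l; lia.
Qed.
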